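(* Let $n\ge 2$, let $\Omega\subset\mathbb{R}^n$ be open, let $G:\mathbb{R}\to\mathbb{R}$ be a smooth function, and let $v:\Omega\to\mathbb{R}$ be a smooth solution of $$|\nabla v|^2 = G(v)\quad\text{in }\Omega,$$ with $v_{x_n}>0$ in $\Omega$. Define the vector field $F=(F_1,\dots,F_{n-1})$ on $\Omega$ by $F_i=\dfrac{v_{x_i}}{v_{x_n}}$, $i=1,\dots,n-1$. Then $F$ satisfies the Euler equations with constant pressure (with $x_n$ playing the role of time) $$F_{x_n}+F\,\nabla_y F=0\quad\text{in }\Omega,\qquad y=(x_1,\dots,x_{n-1}),$$ that is, $(F_i)_{x_n}+\sum_{j=1}^{n-1}F_j\,(F_i)_{x_j}=0$ in $\Omega$ for every $i=1,\dots,n-1$.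
   Context: Subscripts $x_i$ denote partial derivatives with respect to the $i$-th coordinate of $x=(x_1,\dots,x_n)$; $\nabla$ is the full gradient in $\mathbb{R}^n$. No incompressibility condition is part of the stated Euler system here. *)

(* Defs.v *)
From HB Require Import structures.
From mathcomp Require Import all_boot all_order all_algebra.
From mathcomp Require Import boolp classical_sets reals topology normedtype derive.

Set Implicit Arguments.
Unset Strict Implicit.
Unset Printing Implicit Defensive.

Import Order.TTheory GRing.Theory Num.Theory.
Import numFieldNormedType.Exports.

Local Open Scope classical_set_scope.
Local Open Scope ring_scope.

(* Functions on an open set Omega of R^n are total functions on 'rV[R]_n of
   which only the values on Omega matter: at a point of an open set, continuity
   and derivatives are local. *)

Definition unit_vec (R : realType) (n : nat) (i : 'I_n) : 'rV[R]_n :=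
  delta_mx 0 i.

Definition partial (R : realType) (n : nat) (i : 'I_n) (f : 'rV[R]_n -> R) :
    'rV[R]_n -> R :=
  fun x => 'D_(unit_vec R i) f x.

Definition grad (R : realType) (n : nat) (f : 'rV[R]_n -> R)
    (x : 'rV[R]_n) : 'rV[R]_n :=
  \row_i partial i f x.

(* The Euclidean norm; the library's `|_| on matrices is the sup norm. *)
Definition enorm (R : realType) (n : nat) (u : 'rV[R]_n) : R :=
  Num.sqrt (\sum_i u 0 i ^+ 2).

Definition iter_partial (R : realType) (n : nat) (s : seq 'I_n)
    (f : 'rV[R]_n -> R) : 'rV[R]_n -> R :=
  foldr (@partial R n) f s.

(* C^oo on an open set: the partial derivatives of all orders exist and are
   continuous.  Existence is stated separately since 'D is a total operator. *)
Definition smooth_on (R : realType) (n : nat) (Omega : set 'rV[R]_n)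
    (f : 'rV[R]_n -> R) : Prop :=
  forall (s : seq 'I_n) (x : 'rV[R]_n), Omega x ->
    {for x, continuous (iter_partial s f)} /\
    forall i : 'I_n, derivable (iter_partial s f) x (unit_vec R i).

Definition smooth1 (R : realType) (g : R -> R) : Prop :=
  forall (k : nat) (t : R), derivable (derive1n k g) t 1.

(* In R^(m+1), the coordinates of y are indexed by space_idx i with i : 'I_m,
   and the last one, ord_max, plays the role of time. *)
Definition space_idx (m : nat) (i : 'I_m) : 'I_m.+1 :=
  widen_ord (leqnSn m) i.

(* F_t + F . nabla_y F = 0 on Omega, including the existence of the partial
   derivatives involved. *)
Definition euler_constant_pressure (R : realType) (m : nat)
    (Omega : set 'rV[R]_m.+1) (F : 'I_m -> 'rV[R]_m.+1 -> R) : Prop :=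
  forall (i : 'I_m) (x : 'rV[R]_m.+1), Omega x ->
    (forall k : 'I_m.+1, derivable (F i) x (unit_vec R k)) /\
    partial ord_max (F i) x
      + \sum_(j < m) F j x * partial (space_idx j) (F i) x = 0.

(* Main.v *)
(* Differentiating |grad v|^2 = G(v) and using the symmetry of the second
   partial derivatives gives sum_k v_k d_k(v_j) = G'(v)/2 v_j for every j: both
   v_i and v_n are stretched at the same rate G'(v)/2 along the characteristic
   direction grad v, so their quotient F_i is constant along it, and
   grad v = v_n (F, 1).

   Smoothness only provides partial derivatives, so everything is done with
   directional derivatives: the chain rule for G o v along a line, and Schwarz's
   theorem from the mean value theorem applied to second differences. *)

Require Import Defs.
From HB Require Import structures.
From mathcomp Require Import all_boot all_order all_algebra.
From mathcomp Require Import boolp classical_sets reals topology normedtype derive.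
From mathcomp Require Import functions ring lra.
Import Order.TTheory GRing.Theory Num.Theory.
Import numFieldNormedType.Exports.
Local Open Scope classical_set_scope.
Local Open Scope ring_scope.

(** Both sides have the same difference quotient, since [(h + s) *: u + x] is
    [h *: u + (s *: u + x)]. This carries one-variable calculus over to directional derivatives. *)
Lemma is_derive_lineE {R : realType} {V : normedModType R} (f : V -> R)
    (x u : V) (s d : R) :
  is_derive s 1 (fun t : R => f (t *: u + x)) d <->
  is_derive (s *: u + x) u f d.
Proof.
have E : (fun h : R => h^-1 *: (((fun t : R => f (t *: u + x)) \o shift s)
    (h *: (1 : R)) - f (s *: u + x)))
  = (fun h => h^-1 *: ((f \o shift (s *: u + x)) (h *: u) - f (s *: u + x))).
  by apply/funext => h /=; rewrite [h *: 1]mulr1 scalerDl addrA.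
have ED : derivable (fun t : R => f (t *: u + x)) s 1
    = derivable f (s *: u + x) u by rewrite /derivable E.
have EV : 'D_1 (fun t : R => f (t *: u + x)) s = 'D_u f (s *: u + x).
  by rewrite /derive E.
by split=> -[]; rewrite ?ED ?EV => D1 D2; split; rewrite ?ED ?EV.
Qed.

(** As [f] is derivable only along [u], the chain rule is applied on the line through [x], where
    derivable and differentiable coincide. *)
Lemma derive_comp_line {R : realType} {V : normedModType R} (g : R -> R)
    (f : V -> R) (x u : V) :
  derivable f x u -> derivable g (f x) 1 ->
  'D_u (g \o f) x = g^`()%classic (f x) * 'D_u f x.
Proof.
move=> df dg.
have /is_derive_lineE lf : is_derive (0 *: u + x) u f ('D_u f x).
  by rewrite scale0r add0r; exact: derivableP.
have dl := @ex_derive _ _ _ _ _ _ _ lf.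
have dg' : derivable g (f (0 *: u + x)) 1 by rewrite scale0r add0r.
suff /is_derive_lineE : is_derive (0 : R) 1 (fun t : R => (g \o f) (t *: u + x))
    (g^`()%classic (f x) * 'D_u f x).
  by rewrite scale0r add0r => /@derive_val.
have -> : g^`()%classic (f x) * 'D_u f x
    = 'D_1 (g \o (fun t : R => f (t *: u + x))) 0.
  rewrite -derive1E [RHS]derive1_comp//= scale0r add0r.
  by rewrite [X in _ = _ * X]derive1E (@derive_val _ _ _ _ _ _ _ lf).
apply: derivableP; apply/(@derivable1_diffP _ _ (g \o (fun t : R => f (t *: u + x)))).
by apply: differentiable_comp; exact/derivable1_diffP.
Qed.

(* Mean value theorem for [s |-> f (s u + h w + x) - f (s u + x)], then for
   [fu] along [w]. *)
Lemma second_difference_MVT {R : realType} {V : normedModType R}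
    {f fu fuw : V -> R} {x u w : V} {h : R} : 0 < h ->
  (forall s t, 0 <= s <= h -> 0 <= t <= h ->
    is_derive (s *: u + t *: w + x) u f (fu (s *: u + t *: w + x)) /\
    is_derive (s *: u + t *: w + x) w fu (fuw (s *: u + t *: w + x))) ->
  exists s t, [/\ 0 <= s <= h, 0 <= t <= h &
    f (h *: u + h *: w + x) - f (h *: u + x) - f (h *: w + x) + f x
    = h ^+ 2 * fuw (s *: u + t *: w + x)].
Proof.
move=> h0 D.
pose g (s : R) := f (s *: u + (h *: w + x)) - f (s *: u + x).
pose dg (s : R) := fu (s *: u + (h *: w + x)) - fu (s *: u + x).
have h00 : 0 <= (0 : R) <= h by rewrite lexx ltW.
have hh : 0 <= h <= h by rewrite lexx ltW.
have dgP s : 0 <= s <= h -> is_derive s 1 g (dg s).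
  move=> sh; apply: is_deriveB; apply/is_derive_lineE.
    by have [+ _] := D s h sh hh; rewrite addrA.
  by have [+ _] := D s 0 sh h00; rewrite scale0r addr0.
have itvP (s : R) : s \in `]0, h[%R -> 0 <= s <= h.
  by rewrite in_itv/= => /andP[s0 sh]; rewrite !ltW.
have [s /itvP sh Es] : exists2 c, c \in `]0, h[%R & g h - g 0 = dg c * (h - 0).
  apply: (@MVT R g dg) => // [s /itvP/dgP//|].
  by apply: derivable_within_continuous => s; rewrite in_itv/= => /dgP [].
pose k (t : R) := fu (t *: w + (s *: u + x)).
pose dk (t : R) := fuw (t *: w + (s *: u + x)).
have dkP t : 0 <= t <= h -> is_derive t 1 k (dk t).
  move=> th; apply/is_derive_lineE.
  by have [_] := D s t sh th; rewrite -addrA addrCA.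
have [t /itvP th Et] : exists2 c, c \in `]0, h[%R & k h - k 0 = dk c * (h - 0).
  apply: (@MVT R k dk) => // [t /itvP/dkP//|].
  by apply: derivable_within_continuous => t; rewrite in_itv/= => /dkP [].
exists s, t; split => //.
have Edg : dg s = k h - k 0.
  by rewrite /dg /k scale0r add0r addrCA.
move: Es; rewrite Edg Et /g /dk !scale0r !add0r subr0.
rewrite [t *: w + _]addrCA !addrA => Es.
by rewrite expr2 -mulrA mulrC [h * _]mulrC -Es; ring.
Qed.

(** The second difference of [f] on a parallelogram with sides [h *: u] and [h *: w] is symmetric in
    [u] and [w]. It is therefore [h ^+ 2] times a value of [fuw] and also [h ^+ 2] times a value of
    [fwu], both taken near [x]; continuity at [x] concludes. *)
Lemma schwarz {R : realType} {V : normedModType R} {f fu fw fuw fwu : V -> R}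
    {x u w : V} :
  (\forall y \near x, is_derive y u f (fu y) /\ is_derive y w fu (fuw y)) ->
  (\forall y \near x, is_derive y w f (fw y) /\ is_derive y u fw (fwu y)) ->
  {for x, continuous fuw} -> {for x, continuous fwu} -> fuw x = fwu x.
Proof.
move=> Duw Dwu cuw cwu.
apply/eqP; rewrite -subr_eq0 -normr_le0; apply/ler_addgt0Pl => e e0.
rewrite addr0.
have e20 : 0 < e / 2 by rewrite divr_gt0.
have nearx : \forall y \near x,
    [/\ is_derive y u f (fu y) /\ is_derive y w fu (fuw y),
    is_derive y w f (fw y) /\ is_derive y u fw (fwu y),
    `|fuw x - fuw y| < e / 2 & `|fwu x - fwu y| < e / 2].
  move/cvgrPdist_lt/(_ _ e20) : cuw => cuw.
  move/cvgrPdist_lt/(_ _ e20) : cwu => cwu.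
  by near=> y; split; near: y.
have plane : (fun p : R * R => p.1 *: u + p.2 *: w + x) @ ((0 : R), (0 : R))
    --> x.
  rewrite -[X in _ --> X]add0r -[X in _ --> X + _]addr0.
  rewrite -[X in _ --> X + _ + _](scale0r u) -[X in _ --> _ + X + _](scale0r w).
  apply: cvgD; last exact: cvg_cst.
  by apply: cvgD; apply: cvgZr_tmp; [exact: cvg_fst|exact: cvg_snd].
have /nbhs_ballP[r /= r0 rP] := plane _ nearx.
(* Halving keeps the closed square of side [h] inside the open sup-norm ball of radius [r]. *)
pose h := r / 2.
have h0 : 0 < h by rewrite divr_gt0.
have rsq s t : 0 <= s <= h -> 0 <= t <= h ->
    ball ((0 : R), (0 : R)) r (s, t).
  move=> /andP[s0 sh] /andP[t0 th].
  split; rewrite /ball/= sub0r normrN ger0_norm//; rewrite /h in sh th; lra.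
have [s [t [sh th E1]]] : exists s t, [/\ 0 <= s <= h, 0 <= t <= h &
    f (h *: u + h *: w + x) - f (h *: u + x) - f (h *: w + x) + f x
    = h ^+ 2 * fuw (s *: u + t *: w + x)].
  apply: (second_difference_MVT (fu := fu)) => // s1 t1 sh1 th1.
  by have [+ _ _ _] := rP _ (rsq s1 t1 sh1 th1).
have [t' [s' [th' sh' E2]]] : exists t s, [/\ 0 <= t <= h, 0 <= s <= h &
    f (h *: w + h *: u + x) - f (h *: w + x) - f (h *: u + x) + f x
    = h ^+ 2 * fwu (t *: w + s *: u + x)].
  apply: (second_difference_MVT (fu := fw)) => // t1 s1 th1 sh1.
  by rewrite [t1 *: w + _]addrC; have [_ + _ _] := rP _ (rsq s1 t1 sh1 th1).
have [_ _ + _] := rP _ (rsq s t sh th).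
have [_ _ _ +] := rP _ (rsq s' t' sh' th').
rewrite /= [s' *: u + _]addrC.
have -> : fwu (t' *: w + s' *: u + x) = fuw (s *: u + t *: w + x).
  apply: (mulfI (lt0r_neq0 (exprn_gt0 2 h0))).
  by rewrite -E1 -E2 [h *: w + h *: u]addrC; ring.
set b := fuw (_ + x) => Hc Hb.
rewrite (splitr e) (_ : _ - fwu x = fuw x - b - (fwu x - b)); last by ring.
by rewrite (le_trans (ler_normB _ _))// lerD// ltW.
Unshelve. all: by end_near. Qed.

Lemma is_derive_div {R : realType} {V : normedModType R} {f g : V -> R}
    {x u : V} {df dg : R} : g x != 0 ->
  is_derive x u f df -> is_derive x u g dg ->
  is_derive x u (fun y => f y / g y) (df / g x - f x * dg / g x ^+ 2).
Proof.
move=> g0 fP gP; have dg' := @ex_derive _ _ _ _ _ _ _ gP.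
have gVP : is_derive x u (fun y => (g y)^-1) (- g x ^- 2 * dg).
  split; first exact: derivableV.
  by rewrite deriveV// (@derive_val _ _ _ _ _ _ _ gP).
apply: is_derive_eq (is_deriveM fP gVP) _.
by rewrite /GRing.scale/=; field.
Qed.

(* If [d] and [a ord_max] grow at the same rate [r] in the direction [a], where
   [b] and [c] are their gradients, then [d / a ord_max] is constant along [a],
   whence along [a / a ord_max]. *)
Lemma transport_div {K : fieldType} {m : nat} {a b c : 'I_m.+1 -> K} {d r : K} :
  a ord_max != 0 ->
  \sum_k a k * b k = r * d -> \sum_k a k * c k = r * a ord_max ->
  b ord_max / a ord_max - d * c ord_max / a ord_max ^+ 2
  + \sum_(j < m) a (space_idx j) / a ord_max *
      (b (space_idx j) / a ord_max - d * c (space_idx j) / a ord_max ^+ 2) = 0.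
Proof.
(* By the quotient rule, [D k] is the [k]-th partial derivative of the quotient. In the sum below,
   the two contributions of [r] cancel. *)
move=> a0 Eb Ec; pose D k := b k / a ord_max - d * c k / a ord_max ^+ 2.
have : \sum_k a k * D k = 0.
  transitivity ((\sum_k a k * b k) / a ord_max
    - d / a ord_max ^+ 2 * \sum_k a k * c k).
    rewrite mulr_suml mulr_sumr -sumrB; apply: eq_bigr => k _.
    by rewrite /D; field.
  by rewrite Eb Ec; field.
rewrite big_ord_recr/= => ED; apply: (mulfI a0); rewrite mulr0 -[RHS]ED [LHS]mulrDr [RHS]addrC.
congr (_ + _) => //; rewrite mulr_sumr; apply: eq_bigr => j _; rewrite /D.
by rewrite mulrA mulrCA mulfV// mulr1.
Qed.

Theorem proposition2p1 (R : realType) (m : nat) (dim_ge2 : (2 <= m.+1)%N)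
    (Omega : set 'rV[R]_m.+1) (Omega_open : open Omega)
    (G : R -> R) (G_smooth : smooth1 G)
    (v : 'rV[R]_m.+1 -> R) (v_smooth : smooth_on Omega v)
    (v_eikonal : forall x, Omega x -> enorm (grad v x) ^+ 2 = G (v x))
    (v_monotone : forall x, Omega x -> 0 < partial ord_max v x)
    (F : 'I_m -> 'rV[R]_m.+1 -> R)
    (F_def : forall i x, Omega x ->
       F i x = partial (space_idx i) v x / partial ord_max v x) :
  euler_constant_pressure Omega F.
Proof.
pose p k := partial k v.
have v_derivable k y : Omega y -> derivable v y (unit_vec R k).
  by move=> /(v_smooth [::]) [].
have p_derivable k l y : Omega y -> derivable (p k) y (unit_vec R l).
  by move=> /(v_smooth [:: k]) [].
have p_comm k l y : Omega y -> partial l (p k) y = partial k (p l) y.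
  move=> Oy; have nO : \forall z \near y, Omega z by exact: open_nbhs_nbhs.
  have dvp k' l' : \forall z \near y,
      is_derive z (unit_vec R k') v (p k' z) /\
      is_derive z (unit_vec R l') (p k') (partial l' (p k') z).
    near=> z; have Oz : Omega z by near: z.
    by split; [exact/derivableP/v_derivable|exact/derivableP/p_derivable].
  apply: (schwarz (dvp k l) (dvp l k)).
  - by have [] := v_smooth [:: l; k] _ Oy.
  - by have [] := v_smooth [:: k; l] _ Oy.
move=> i x Ox.
have nO : \forall y \near x, Omega y by exact: open_nbhs_nbhs.
pose P := p ord_max.
have P0 : P x != 0 by rewrite gt_eqF// v_monotone.
(* Along the [j]-th direction the equation yields [2 * p k * partial j (p k)] summed over [k];
   [p_comm] then moves the derivative onto [p j]. *)
have eikonal j : \sum_k p k x * partial k (p j) x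
    = G^`()%classic (v x) / 2 * p j x.
  have eqG : \forall y \near x, (\sum_k p k ^+ 2) y = (G \o v) y.
    near=> y; have Oy : Omega y by near: y.
    rewrite /= -v_eikonal// /enorm sqr_sqrtr; last first.
      by apply: sumr_ge0 => k _; exact: sqr_ge0.
    by rewrite fct_sumE; apply: eq_bigr => k _; rewrite mxE.
  have := @near_eq_derive _ _ _ _ _ _ (unit_vec R j) eqG.
  rewrite derive_comp_line; [|exact: v_derivable|exact: (G_smooth 0%N)].
  rewrite derive_sum; last by move=> k; exact/derivableX/p_derivable.
  move=> E; rewrite mulrAC -[_ * p j x]E mulr_suml; apply: eq_bigr => k _.
  rewrite deriveX; last exact: p_derivable.
  rewrite expr1 -[X in _ *: X]/(partial j (p k) x) p_comm//.
  by rewrite -[_ *: _]/(_ * _); field.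
have FE j : F j x = p (space_idx j) x / P x by rewrite F_def.
have dF k : is_derive x (unit_vec R k) (F i)
    (partial k (p (space_idx i)) x / P x
     - p (space_idx i) x * partial k P x / P x ^+ 2).
  (* [F] is prescribed on [Omega] only; openness makes it agree with the quotient near [x], so the
     derivatives agree too. *)
  have eqF : \forall y \near x, p (space_idx i) y / P y = F i y.
    by near=> y; rewrite F_def//; near: y.
  apply: near_eq_is_derive eqF _.
  by apply: is_derive_div => //; exact/derivableP/p_derivable.
split=> [k|]; first by case: (dF k).
have partialF k : partial k (F i) x = partial k (p (space_idx i)) x / P x
     - p (space_idx i) x * partial k P x / P x ^+ 2.
  by case: (dF k).
under eq_bigr do rewrite FE partialF.
rewrite partialF.
(* Here [a] is the gradient of [v] at [x], [d] is its [i]-th component, and the common rate [r] is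
   half of the derivative of [G] at [v x]. *)
exact: (transport_div P0 (eikonal (space_idx i)) (eikonal ord_max)).
Unshelve. all: by end_near. Qed.
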